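(* Let $\psi: T \to \mathbb{C}$ be a function and $\varphi: T \to T$ a self-map for which $W_{\psi,\varphi}$ is bounded on $L_\mu^\infty$. Then $W_{\psi,\varphi}$ is an isometry on $L_\mu^\infty$ if and only if $\varphi$ is surjective and $$\sup_{v \in S_w} \frac{\mu(v)}{\mu(\varphi(v))}|\psi(v)| = 1 \quad \text{for all } w \in T,$$ where $S_w = \{v \in T : \varphi(v) = \varphi(w)\}$. Moreover, $W_{\psi,\varphi}$ is a surjective isometry on $L_\mu^\infty$ if and only if $\varphi$ is a bijection and $$\frac{\mu(v)}{\mu(\varphi(v))}|\psi(v)| = 1 \quad \text{for all } v \in T.$$
   Context: $(T,\mathrm{d})$ is a metric space with a distinguished point $o$ (the root); the length of $v \in T$ is $|v| = \mathrm{d}(o,v)$. $T$ is assumed locally finite (for every $M>0$ the set $\{v \in T : |v| < M\}$ is finite) and unbounded (for every $M>0$ there is $v \in T$ with $|v| \ge M$). $\mu: T \to (0,\infty)$ is an arbitrary positive function (a weight). $L_\mu^\infty$ is the Banach space of functions $f: T \to \mathbb{C}$ with $\|f\|_\mu = \sup_{v \in T} \mu(v)|f(v)| < \infty$. The weighted composition operator is the linear map $W_{\psi,\varphi} f = \psi\,(f\circ\varphi)$; it is bounded on $L_\mu^\infty$ if it is a bounded operator from $L_\mu^\infty$ to itself. It is an isometry on $L_\mu^\infty$ if $\|W_{\psi,\varphi} f\|_\mu = \|f\|_\mu$ for all $f \in L_\mu^\infty$. *)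

(* Defs.v *)
From HB Require Import structures.
From mathcomp Require Import all_boot all_order all_algebra.
From mathcomp Require Import all_classical all_reals all_analysis.
From mathcomp Require Import complex.
Set Implicit Arguments.
Unset Strict Implicit.
Unset Printing Implicit Defensive.
Import Order.TTheory GRing.Theory Num.Theory.
Import ComplexField.Normc.
Local Open Scope classical_set_scope.
Local Open Scope ring_scope.

Section RootedMetricSpace.
Context {R : realType} {T : metricType R}.

Definition vlength (o v : T) : R := mdist o v.

Definition locally_finite (o : T) : Prop :=
  forall M : R, 0 < M -> finite_set [set v : T | vlength o v < M].

Definition unbounded_space (o : T) : Prop :=
  forall M : R, 0 < M -> exists v : T, M <= vlength o v.

End RootedMetricSpace.

Section WeightedSpace.
Context {R : realType} {T : Type}.
Implicit Types (mu : T -> R) (f : T -> R[i]).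

(* [normc] is the R-valued modulus, whereas `|z| lives in R[i]. The norm takes
   values in the extended reals and is +oo outside Linfty. *)
Definition wnorm mu f : \bar R :=
  ereal_sup [set (mu v * normc (f v))%:E | v in [set: T]].

Definition Linfty mu : set (T -> R[i]) := [set f | (wnorm mu f < +oo)%E].

(* An operator on Linfty is represented by a map on all functions, of which only
   the restriction to Linfty matters. *)
Implicit Type A : (T -> R[i]) -> (T -> R[i]).

Definition bounded_on_Linfty mu A : Prop :=
  set_fun (Linfty mu) (Linfty mu) A /\
  exists C : R, forall f, Linfty mu f ->
    (wnorm mu (A f) <= C%:E * wnorm mu f)%E.

Definition isometry_on_Linfty mu A : Prop :=
  forall f, Linfty mu f -> wnorm mu (A f) = wnorm mu f.

Definition surjective_isometry_on_Linfty mu A : Prop :=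
  isometry_on_Linfty mu A /\ set_surj (Linfty mu) (Linfty mu) A.

Definition wcomp (psi : T -> R[i]) (phi : T -> T) f : T -> R[i] :=
  psi \* (f \o phi).

Definition fiber_class (phi : T -> T) (w : T) : set T :=
  [set v | phi v = phi w].

End WeightedSpace.

(* Main.v *)
(** Test the isometry on the indicator of a point [u]: it has norm [mu u], and
    its image is supported on the fiber of [phi] over [u], where it has norm
    [mu u] times the supremum of the weight quotient over that fiber. Hence an
    isometry has no empty fiber and all these suprema equal [1]. Conversely,
    splitting the supremum defining the norm of the image of [f] along the
    fibers recovers the norm of [f], even when it is infinite. If the isometry
    is onto, the indicators of single points lie in its range, which consists of
    multiples of functions constant on fibers, so the fibers are singletons. *)
Require Import Defs.
From mathcomp Require Import all_boot all_order all_algebra.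
From mathcomp Require Import all_classical all_reals all_analysis.
From mathcomp Require Import complex ring.
Import Order.TTheory GRing.Theory Num.Theory.
Import ComplexField.Normc.
Local Open Scope classical_set_scope.
Local Open Scope ring_scope.

Lemma normc_ge0 {R : realType} (z : R[i]) : 0 <= normc z.
Proof. by case: z => a b; exact: sqrtr_ge0. Qed.

Lemma wnorm_ge {R : realType} {T : Type} (mu : T -> R) (f : T -> R[i]) (v : T) :
  ((mu v * normc (f v))%:E <= wnorm mu f)%E.
Proof. by apply: ereal_sup_ubound; exists v. Qed.

Lemma wnorm_le {R : realType} {T : Type} (mu : T -> R) (f : T -> R[i])
    (x : \bar R) :
  (forall v, ((mu v * normc (f v))%:E <= x)%E) -> (wnorm mu f <= x)%E.
Proof. by move=> fx; apply: ge_ereal_sup => _ [v _ <-]. Qed.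

Definition point_mass {R : realType} {T : eqType} (u : T) : T -> R[i] :=
  fun v => (v == u)%:R.

Lemma wnorm_point_mass {R : realType} {T : eqType} (mu : T -> R)
    (mu_gt0 : forall v, 0 < mu v) (u : T) :
  wnorm mu (point_mass u) = (mu u)%:E.
Proof.
apply/eqP; rewrite eq_le; apply/andP; split.
  apply: wnorm_le => v; rewrite lee_fin /point_mass.
  by have [->|_] := eqVneq v u; rewrite ?normc1 ?mulr1 // normc0 mulr0 ltW.
by have := wnorm_ge mu (point_mass u) u; rewrite /point_mass eqxx normc1 mulr1.
Qed.

Lemma Linfty_point_mass {R : realType} {T : eqType} (mu : T -> R)
    (mu_gt0 : forall v, 0 < mu v) (u : T) :
  Linfty mu (point_mass u).
Proof. by rewrite /Linfty /= wnorm_point_mass // ltry. Qed.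

Section WeightedComposition.
Context {R : realType} {T : eqType} (mu : T -> R).
Context (psi : T -> R[i]) (phi : T -> T).
Context (mu_gt0 : forall v, 0 < mu v).

Let ratio (v : T) : R := mu v / mu (phi v) * normc (psi v).

Let fiber_sup (w : T) : \bar R :=
  ereal_sup [set (ratio v)%:E | v in fiber_class phi w].

(** Inserting and cancelling [mu (phi v)] separates the weighted size of [f] at [phi v] from a
    factor independent of [f]. *)
Lemma wcomp_weight (f : T -> R[i]) (v : T) :
  mu v * normc (wcomp psi phi f v) = mu (phi v) * normc (f (phi v)) * ratio v.
Proof.
rewrite /wcomp /ratio /= normcM.
by field; rewrite gt_eqF.
Qed.

(** [f \o phi] is constant on the fiber, so its weighted modulus is a nonnegative real that factors
    out of the supremum. *)
Lemma fiber_sup_wcomp (f : T -> R[i]) (w : T) :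
  ereal_sup [set (mu v * normc (wcomp psi phi f v))%:E | v in fiber_class phi w]
  = ((mu (phi w) * normc (f (phi w)))%:E * fiber_sup w)%E.
Proof.
rewrite -ereal_supZl; last 2 first.
- by apply/set0P; exists (ratio w)%:E; exists w.
- by rewrite mulr_ge0 ?normc_ge0 ?ltW.
rewrite image_comp; congr ereal_sup; apply: eq_imagel => v phivw.
by rewrite /= wcomp_weight phivw EFinM.
Qed.

Lemma fiber_sup_wcomp_le (f : T -> R[i]) (w : T) :
  ((mu (phi w) * normc (f (phi w)))%:E * fiber_sup w
     <= wnorm mu (wcomp psi phi f))%E.
Proof. by rewrite -fiber_sup_wcomp; apply: ereal_sup_le => _ [v _ <-]; exists v. Qed.

Lemma wnorm_wcomp_point_mass (w : T) :
  wnorm mu (wcomp psi phi (point_mass (phi w)))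
  = ((mu (phi w))%:E * fiber_sup w)%E.
Proof.
have E : normc (point_mass (R := R) (phi w) (phi w)) = 1.
  by rewrite /point_mass eqxx normc1.
have := fiber_sup_wcomp_le (point_mass (phi w)) w.
have := fiber_sup_wcomp (point_mass (phi w)) w.
rewrite E mulr1 => fibE le; apply/eqP; rewrite eq_le le andbT -fibE.
apply: wnorm_le => v; have [phivw|phivw] := eqVneq (phi v) (phi w).
  by apply: ereal_sup_ubound; exists v.
(* Off the fiber the image vanishes; the supremum over the fiber is still at least 0, since [w]
   itself contributes a nonnegative term. *)
apply: le_trans (_ : 0 <= _)%E.
  by rewrite wcomp_weight /point_mass (negPf phivw) normc0 mulr0 mul0r.
apply: le_trans (ereal_sup_ubound _); last by exists w.
by rewrite lee_fin mulr_ge0 ?normc_ge0 ?ltW.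
Qed.

(** The point mass at a point outside the range of [phi] would be sent to 0, although its norm
    [mu u] is positive. *)
Lemma isometry_surj :
  isometry_on_Linfty mu (wcomp psi phi) -> set_surj [set: T] [set: T] phi.
Proof.
move=> iso u _; apply: contrapT => nu.
have : (wnorm mu (wcomp psi phi (point_mass u)) <= 0)%E.
  apply: wnorm_le => v; rewrite wcomp_weight /point_mass.
  have [phivu|_] := eqVneq (phi v) u; first by case: nu; exists v.
  by rewrite normc0 mulr0 mul0r.
rewrite iso; last exact: Linfty_point_mass.
by rewrite wnorm_point_mass // lee_fin leNgt mu_gt0.
Qed.

Lemma isometry_fiber_sup (w : T) :
  isometry_on_Linfty mu (wcomp psi phi) -> fiber_sup w = 1%E.
Proof.
move=> iso; have := iso _ (Linfty_point_mass mu mu_gt0 (phi w)).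
rewrite wnorm_wcomp_point_mass wnorm_point_mass // => E.
(* [fiber_sup w] is an extended real, so [mu (phi w)] is cancelled by multiplying with its finite
   inverse. *)
have /(congr1 (fun x => ((mu (phi w))^-1%:E * x)%E)) := E.
by rewrite muleA -!EFinM mulVf ?gt_eqF // mul1e.
Qed.

(** For the upper bound every [ratio v] is at most 1; for the lower bound every point is some
    [phi w], and the fiber of [w] transmits its full weight. *)
Lemma wnorm_wcomp (f : T -> R[i]) :
  set_surj [set: T] [set: T] phi -> (forall w, fiber_sup w = 1%E) ->
  wnorm mu (wcomp psi phi f) = wnorm mu f.
Proof.
move=> surj sup1; apply/eqP; rewrite eq_le; apply/andP; split.
  apply: wnorm_le => v; apply: le_trans (wnorm_ge mu f (phi v)).
  rewrite wcomp_weight lee_fin ler_piMr //.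
    by rewrite mulr_ge0 ?normc_ge0 ?ltW.
  rewrite -lee_fin -[leRHS](sup1 v).
  by apply: ereal_sup_ubound; exists v.
apply: wnorm_le => u; have [w _ <-] := surj u I.
by have := fiber_sup_wcomp_le f w; rewrite sup1 mule1.
Qed.

Lemma fiber_sup_inj (w : T) : injective phi -> fiber_sup w = (ratio w)%:E.
Proof.
move=> inj; rewrite /fiber_sup.
have -> : fiber_class phi w = [set w].
  by apply/seteqP; split=> v /= => [/inj|->].
by rewrite image_set1 ereal_sup1.
Qed.

Lemma range_point_mass_inj :
  (forall u, exists f, wcomp psi phi f = point_mass u) -> injective phi.
Proof.
move=> ran v1 v2 phi12; apply/eqP/negPn/negP => v12.
have [f Wf] := ran v1.
have /eqP := congr1 (fun g => g v1) Wf.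
have /eqP := congr1 (fun g => g v2) Wf.
rewrite /wcomp /= /point_mass eqxx [v2 == v1]eq_sym (negPf v12) phi12.
(* Both images involve the same value of [f]. If it is 0, the image cannot be 1 at [v1]; if [psi v2]
   is 0, every image vanishes at [v2], and the point mass there is not attained. *)
rewrite mulf_eq0 => /orP[|] /eqP z0; last first.
  by rewrite z0 mulr0 eq_sym oner_eq0.
have [g Wg] := ran v2.
have /eqP := congr1 (fun h => h v2) Wg.
by rewrite /wcomp /= /point_mass eqxx z0 mul0r eq_sym oner_eq0.
Qed.

(** The preimage is [g / psi] transported by the inverse of [phi]; [psi] has no zero because [ratio]
    is 1 everywhere. *)
Lemma wcomp_surj :
  set_bij [set: T] [set: T] phi -> (forall v, ratio v = 1) ->
  forall g, exists f, wcomp psi phi f = g.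
Proof.
move=> [_ inj surj] ratio1 g.
have /choice[phi' phi'K] : forall u, exists v, phi v = u.
  by move=> u; have [v _ <-] := surj u I; exists v.
exists (fun u => g (phi' u) / psi (phi' u)); apply/funext => v.
have -> : (wcomp psi phi (fun u => g (phi' u) / psi (phi' u))) v
    = psi v * (g (phi' (phi v)) / psi (phi' (phi v))) by [].
have -> : phi' (phi v) = v by apply: inj; rewrite ?in_setT ?phi'K.
rewrite mulrC divfK //; apply/eqP => psi0.
by have /eqP := ratio1 v; rewrite /ratio psi0 normc0 mulr0 eq_sym oner_eq0.
Qed.

End WeightedComposition.

Theorem theorem6p2 (R : realType) (T : metricType R) (o : T)
    (T_locally_finite : locally_finite o)
    (T_unbounded : unbounded_space o)
    (mu : T -> R) (mu_gt0 : forall v : T, 0 < mu v)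
    (psi : T -> R[i]) (phi : T -> T)
    (W_bounded : bounded_on_Linfty mu (wcomp psi phi)) :
  (isometry_on_Linfty mu (wcomp psi phi) <->
     set_surj [set: T] [set: T] phi /\
     forall w : T,
       ereal_sup [set (mu v / mu (phi v) * normc (psi v))%:E
                 | v in fiber_class phi w] = 1%E) /\
  (surjective_isometry_on_Linfty mu (wcomp psi phi) <->
     set_bij [set: T] [set: T] phi /\
     forall v : T,
       mu v / mu (phi v) * normc (psi v) = 1).
Proof.
have isoP : isometry_on_Linfty mu (wcomp psi phi) <->
     set_surj [set: T] [set: T] phi /\
     forall w : T,
       ereal_sup [set (mu v / mu (phi v) * normc (psi v))%:E
                 | v in fiber_class phi w] = 1%E.
  split=> [iso|[surj sup1] f _]; last exact: wnorm_wcomp.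
  split; first exact: isometry_surj iso.
  by move=> w; exact: isometry_fiber_sup.
split=> //; split=> [[iso ran]|[bij ratio1]].
  have [surj sup1] := isoP.1 iso.
  have inj : injective phi.
    apply: (range_point_mass_inj psi) => u.
    by have [f _ <-] := ran _ (Linfty_point_mass mu mu_gt0 u); exists f.
  split; first by split=> // v1 v2 _ _; exact: inj.
  by move=> v; have := sup1 v; rewrite fiber_sup_inj // => -[].
have [_ inj surj] := bij.
have sup1 w : ereal_sup [set (mu v / mu (phi v) * normc (psi v))%:E
                 | v in fiber_class phi w] = 1%E.
  by rewrite fiber_sup_inj ?ratio1 // => v1 v2; apply: inj; rewrite in_setT.
split; first exact/isoP.
move=> g g_fin; have [f Wf] := wcomp_surj _ _ _ bij ratio1 g.
(* [f] is not yet known to lie in [Linfty mu]; norm preservation for arbitrary functions gives it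
   the finite norm of [g]. *)
by exists f => //; rewrite /Linfty /= -(wnorm_wcomp _ psi phi) // Wf.
Qed.
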